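(* Fix an integer $k\geq 1$. For integers $n\ge k$ let $W_{n,k}(x)=\sum_{m=0}^{k}w_{n,k,m}x^m$, where $w_{n,k,m}$ is the number of Dyck paths of semilength $n$ with exactly $k$ occurrences of the factor $UD$ and exactly $m$ occurrences of the factor $UUD$. Then the polynomial sequence $\{W_{n,k}(x)\}_{n\geq k}$ is a generalized Sturm sequence, i.e. $W_{n,k}(x)\preccurlyeq W_{n+1,k}(x)$ for all $n\ge k$.
   Context: A Dyck path of semilength $n$ is a lattice path from $(0,0)$ to $(2n,0)$ with steps $U=(1,1)$ and $D=(1,-1)$ never going below the $x$-axis; it is identified with its word in $\{U,D\}$, and a $UD$-factor (resp. $UUD$-factor) is an occurrence of the consecutive subword $UD$ (resp. $UUD$). Explicitly, $w_{n,k,m}=\frac{1}{k}\binom{n}{k-1}\binom{n-k-1}{m-1}\binom{k}{m}$ if $0<m\le k$ and $k+m\le n$; $w_{n,k,m}=1$ if $m=0$ and $n=k$; and $w_{n,k,m}=0$ otherwise. Each $W_{n,k}(x)$ is real-rooted with nonnegative coefficients. Interlacing: for real-rooted polynomials $F,G$ with nonnegative coefficients, with zeros $\alpha_1\ge\alpha_2\ge\cdots$ of $F$ and $\beta_1\ge\beta_2\ge\cdots$ of $G$, one writes $G\preccurlyeq F$ if either $\deg F=\deg G=n$ and $\beta_n\le\alpha_n\le\beta_{n-1}\le\alpha_{n-1}\le\cdots\le\beta_1\le\alpha_1$, or $\deg F=\deg G+1=n$ and $\alpha_n\le\beta_{n-1}\le\alpha_{n-1}\le\cdots\le\beta_1\le\alpha_1$.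 By convention $a\preccurlyeq bx+c$ for all real $a,b,c$, and $F\preccurlyeq 0$, $0\preccurlyeq F$ for every real-rooted $F$. A sequence $\{F_i(x)\}$ of real-rooted polynomials is a generalized Sturm sequence if $F_i\preccurlyeq F_{i+1}$ for all consecutive indices. *)

(* Defs.v *)
From HB Require Import structures.
From mathcomp Require Import all_boot all_order all_algebra.

Set Implicit Arguments.
Unset Strict Implicit.
Unset Printing Implicit Defensive.

Import Order.TTheory GRing.Theory Num.Theory.
Local Open Scope ring_scope.

(* A lattice path is identified with its word of steps: true is the up step
   U = (1,1), false is the down step D = (1,-1). *)
Notation stepU := true (only parsing).
Notation stepD := false (only parsing).

Definition height (s : seq bool) : int := \sum_(b <- s) (if b then 1 else -1).

Definition dyck (s : seq bool) : bool :=
  (height s == 0) && all (fun i => 0 <= height (take i s)) (iota 0 (size s).+1).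

(* Occurrences of u as a consecutive subword of s, overlaps allowed; meant for
   nonempty u. *)
Definition occ (u s : seq bool) : nat :=
  count (fun i => prefix u (drop i s)) (iota 0 (size s)).

Definition w (n k m : nat) : nat :=
  #|[set p : (n.*2).-tuple bool |
      [&& dyck p, occ [:: stepU; stepD] p == k
        & occ [:: stepU; stepU; stepD] p == m]]|.

Definition W (R : rcfType) (n k : nat) : {poly R} :=
  \sum_(0 <= m < k.+1) (w n k m)%:R *: 'X^m.

(* s lists the zeros of p with multiplicity in weakly decreasing order, and p
   has no other zeros. For p != 0 this determines s, and size s = deg p; for
   p = 0 every sorted s qualifies, so 0 counts as real-rooted. *)
Definition zeros_of (R : rcfType) (p : {poly R}) (s : seq R) : Prop :=
  sorted >=%O s /\ p = lead_coef p *: \prod_(a <- s) ('X - a%:P).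

Definition real_rooted (R : rcfType) (p : {poly R}) : Prop :=
  exists s, zeros_of p s.

Definition nonneg_coefs (R : rcfType) (p : {poly R}) : Prop :=
  forall i, 0 <= p`_i.

(* The relation G ≼ F. With 0-based indices, the chain
   ... <= beta_1 <= alpha_0 reads beta_i <= alpha_i for i < deg G and
   alpha_(i+1) <= beta_i for i + 1 < deg F, both when deg F = deg G and when
   deg F = deg G + 1. The last three clauses are the conventions
   a ≼ bx + c, G ≼ 0 and 0 ≼ F. *)
Definition interlaces (R : rcfType) (G F : {poly R}) : Prop :=
  [\/ [/\ F != 0, G != 0, nonneg_coefs F, nonneg_coefs G &
        (size F = size G \/ size F = (size G).+1) /\
        exists alpha beta : seq R,
          [/\ zeros_of F alpha, zeros_of G beta,
              forall i, (i < size beta)%N -> beta`_i <= alpha`_i &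
              forall i, (i.+1 < size alpha)%N -> alpha`_i.+1 <= beta`_i]],
      exists a b c : R, G = a%:P /\ F = b *: 'X + c%:P,
      F = 0 /\ real_rooted G
    | G = 0 /\ real_rooted F].

(* Only the terms F i with i >= i0 belong to the sequence. *)
Definition generalized_Sturm (R : rcfType) (i0 : nat) (F : nat -> {poly R}) :
    Prop :=
  (forall i, (i0 <= i)%N -> real_rooted (F i)) /\
  (forall i, (i0 <= i)%N -> interlaces (F i) (F i.+1)).

(* Main.v *)
(** A Dyck path followed by a down step is a word U^(c_0) D ... U^(c_n) D whose
    runs satisfy c_0 + ... + c_n = n and c_0 + ... + c_(i-1) >= i for i <= n, a
    Łukasiewicz sequence. Its UD- and UUD-factors are counted by the entries
    that are at least 1 and at least 2, so they do not change when c is rotated,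
    whereas by the cycle lemma exactly one of the n+1 rotations of any c of sum
    n is Łukasiewicz. Choosing the entries of c that are at least 1, then those
    that are at least 2, gives for n > k
      (n+1) w(n,k,m) = C(n+1,k) C(k,m) C(n-k-1,m-1).

    So W_(n,k) is a positive multiple of x Q_r with r = n-k-1 and
    Q_r = sum_j C(k,j+1) C(r,j) x^j = k 2F1(1-k,-r;2;x). Gauss' contiguous
    relation reads
      (r+2) Q_(r+1) = (2r+2 + (k-1-r) x) Q_r + r (x-1) Q_(r-1).
    As x-1 < 0 for x <= 0, Q_(r+1) and Q_(r-1) have opposite signs at the zeros
    of Q_r, and the interlacing follows by induction on r from sign changes. *)

Require Import Defs.
From mathcomp Require Import all_boot all_order all_algebra polyrcf.
From mathcomp Require Import zify ring lra.

Set Implicit Arguments.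
Unset Strict Implicit.
Unset Printing Implicit Defensive.

Import Order.TTheory GRing.Theory Num.Theory.

(** * The cycle lemma *)

Lemma count_least_element (T : eqType) (leT : rel T) (s : seq T) :
  total leT -> transitive leT -> antisymmetric leT -> uniq s -> s != [::] ->
  count (fun x => all (leT x) s) s = 1.
Proof.
move=> leT_total leT_trans leT_asym; rewrite -(sort_uniq leT) -size_eq0.
rewrite -(size_sort leT) -(permP (permEl (perm_sort leT s))).
rewrite (eq_count (fun x => esym (perm_all _ (permEl (perm_sort leT s))))).
have := sort_sorted leT_total s; case: (sort leT s) => // x t /= le_xt.
case/andP=> x_notin_t _ _; have x_least := order_path_min leT_trans le_xt.
have -> : leT x x by have := leT_total x x; rewrite orbb.
rewrite x_least (@eq_in_count _ _ pred0) ?count_pred0 // => y y_t.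
apply/negP => /andP[le_yx _]; case/negP: x_notin_t.
by rewrite (leT_asym x y) // le_yx (allP x_least).
Qed.

Local Open Scope ring_scope.

(* The sum of the whole sequence is left out. *)
Definition nonneg_partial_sums (h : int) (s : seq int) : bool :=
  all (fun i => 0 <= h + \sum_(x <- take i s) x) (iota 0 (size s)).

Lemma nonneg_partial_sums_cons (h x : int) (s : seq int) :
  nonneg_partial_sums h (x :: s) = (0 <= h) && nonneg_partial_sums (h + x) s.
Proof.
rewrite /nonneg_partial_sums /= big_nil addr0 -[1%N]addn0 iotaDl all_map.
by congr (_ && _); apply: eq_all => i /=; rewrite big_cons addrA.
Qed.

Lemma nonneg_partial_sums_cat (h : int) (s t : seq int) :
  nonneg_partial_sums h (s ++ t) =
  nonneg_partial_sums h s && nonneg_partial_sums (h + \sum_(x <- s) x) t.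
Proof.
elim: s h => [|x s IHs] h; first by rewrite big_nil addr0.
by rewrite cat_cons !nonneg_partial_sums_cons IHs big_cons addrA andbA.
Qed.

Lemma nonneg_partial_sums_take (h : int) (i : nat) (s : seq int) :
  (i <= size s)%N ->
  nonneg_partial_sums h (take i s) =
  all (fun j => 0 <= h + \sum_(x <- take j s) x) (iota 0 i).
Proof.
move=> le_is; rewrite /nonneg_partial_sums size_takel //.
by apply: eq_in_all => j; rewrite mem_iota => lt_ji; rewrite take_takel // ltnW.
Qed.

Lemma nonneg_partial_sums_drop (h : int) (i : nat) (s : seq int) :
  nonneg_partial_sums (h + \sum_(x <- take i s) x) (drop i s) =
  all (fun j => 0 <= h + \sum_(x <- take j s) x) (iota i (size s - i)).
Proof.
rewrite /nonneg_partial_sums size_drop -{4}[i]addn0 iotaDl all_map.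
by apply: eq_all => j /=; rewrite takeD big_cat addrA.
Qed.

(* The rotation must start at the first minimum of the partial sums. *)
Lemma cycle_lemma (s : seq int) :
  \sum_(x <- s) x = -1 ->
  count (fun i => nonneg_partial_sums 0 (rot i s)) (iota 0 (size s)) = 1%N.
Proof.
move=> sum_s; pose S i : int := \sum_(x <- take i s) x.
pose first_le i j := (S i < S j) || (S i == S j) && (i <= j)%N.
have s_neq0 : size s != 0%N.
  by apply/negP => /nilP s0; move: sum_s; rewrite s0 big_nil.
rewrite -(@count_least_element _ first_le (iota 0 (size s))) ?iota_uniq //.
- apply: eq_in_count => i; rewrite mem_iota add0n => /= lt_is.
  have le_is := ltnW lt_is.
  have sum_drop : 0 + \sum_(x <- drop i s) x = - 1 - S i.
    by rewrite -sum_s -{2}(cat_take_drop i s) big_cat /= /S; ring.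
  rewrite -(subnKC le_is) iotaD all_cat add0n nonneg_partial_sums_cat sum_drop.
  rewrite nonneg_partial_sums_take // -{1}(addNr (S i)).
  rewrite nonneg_partial_sums_drop andbC.
  congr (_ && _); apply: eq_in_all => j; rewrite mem_iota => le_j.
    by rewrite /first_le -/(S j); lia.
  by rewrite /first_le -/(S j); lia.
- by move=> i j; rewrite /first_le; lia.
- by move=> i j l; rewrite /first_le; lia.
- by move=> i j; rewrite /first_le; lia.
by rewrite -size_eq0 size_iota.
Qed.

Local Close Scope ring_scope.

(** * Counting compositions *)

Fixpoint weak_compositions (L u : nat) : seq (seq nat) :=
  if L is L'.+1
  then [seq x :: c | x <- iota 0 u.+1, c <- weak_compositions L' (u - x)]
  else nseq (u == 0) [::].

Definition num_compositions (k u : nat) : nat :=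
  count (all (leq 1)) (weak_compositions k u).

Lemma mem_weak_compositions (L u : nat) (c : seq nat) :
  (c \in weak_compositions L u) = (size c == L) && (sumn c == u).
Proof.
elim: L u c => [|L IHL] u c.
  by rewrite mem_nseq; case: c; case: u => //= *; rewrite ?andbF.
apply/allpairsPdep/idP => [[x [d [+ + ->]]]|].
  by rewrite mem_iota IHL /=; lia.
case: c => // x c /andP[/eqP[size_c] /eqP sum_c]; exists x, c.
by rewrite mem_iota IHL size_c -sum_c addKn !eqxx /= ltnS leq_addr.
Qed.

Lemma weak_compositions_uniq (L u : nat) : uniq (weak_compositions L u).
Proof.
elim: L u => [|L IHL] u; first by case: u.
apply: allpairs_uniq_dep => [|x _|]; [exact: iota_uniq | exact: IHL |].
by move=> [x c] [y d] _ _ /= [-> ->].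
Qed.

Lemma count_weak_compositionsS (P : pred (seq nat)) (L u : nat) :
  count P (weak_compositions L.+1 u) =
  \sum_(x < u.+1)
    count (fun c => P ((x : nat) :: c)) (weak_compositions L (u - x)).
Proof.
rewrite count_flatten -map_comp sumnE big_map -val_enum_ord big_map.
by rewrite big_enum; apply: eq_bigr => x _; rewrite /= count_map.
Qed.

Lemma size_weak_compositions (L u : nat) :
  size (weak_compositions L.+1 u) = 'C(L + u, L).
Proof.
rewrite -count_predT; elim: L u => [|L IHL] u.
  rewrite count_weak_compositionsS bin0 big_ord_recr /= subnn big1 // => x _.
  by rewrite subn_eq0 leqNgt ltn_ord.
rewrite count_weak_compositionsS (reindex_inj rev_ord_inj) /=.
under eq_bigr => x _ do rewrite subSS subKn -1?ltnS // IHL.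
elim: u => [|u IHu]; first by rewrite big_ord1 !addn0 !binn.
by rewrite big_ord_recr /= IHu addSnnS -binS.
Qed.

(* Choose which entries are nonzero, then their values. *)
Lemma count_nonzero_entries (P : pred (seq nat)) (L k u : nat) :
  count (fun c => let d := filter (leq 1) c in (size d == k) && P d)
    (weak_compositions L u) =
  'C(L, k) * count (fun c => all (leq 1) c && P c) (weak_compositions k u).
Proof.
elim: L k u P => [|L IHL] k u P.
  by case: k => [|k]; rewrite ?bin0 ?mul1n /= !count_nseq.
rewrite count_weak_compositionsS big_ord_recl /= subn0 IHL.
case: k => [|k] /=.
  by rewrite big1 ?addn0 ?bin0 // => x _; rewrite count_pred0.
rewrite binS mulnDl; congr (_ + _).
rewrite [in RHS]count_weak_compositionsS big_ord_recl /= count_pred0 add0n.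
rewrite big_distrr; apply: eq_bigr => x _ /=.
by rewrite -(IHL k _ (fun c => P (x.+1 :: c))); apply: eq_count.
Qed.

Lemma perm_positive_weak_compositions (L u : nat) :
  perm_eq [seq c <- weak_compositions L (L + u) | all (leq 1) c]
    [seq map succn c | c <- weak_compositions L u].
Proof.
have sum_succn c : sumn (map succn c) = size c + sumn c.
  by elim: c => //= x c ->; lia.
apply: uniq_perm => [||c].
- exact/filter_uniq/weak_compositions_uniq.
- by rewrite map_inj_uniq ?weak_compositions_uniq //; apply/inj_map/succn_inj.
rewrite mem_filter mem_weak_compositions.
apply/and3P/mapP => [[c_gt0]|[d + ->]].
  have cE : c = map succn (map predn c).
    by rewrite -map_comp map_id_in // => x /(allP c_gt0); case: x.
  rewrite cE sum_succn !size_map => /eqP size_c sum_c.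
  by exists (map predn c); rewrite // mem_weak_compositions size_map; lia.
rewrite mem_weak_compositions sum_succn size_map all_map.
by move=> /andP[/eqP<- /eqP->]; split=> //; apply/allP.
Qed.

Lemma num_compositions_small (k u : nat) : u < k -> num_compositions k u = 0.
Proof.
rewrite ltnNge => /negP not_le_ku; apply/eqP.
rewrite -leqn0 leqNgt -has_count; apply/hasP => -[c].
rewrite mem_weak_compositions => /andP[/eqP size_c /eqP sum_c] c_gt0.
apply: not_le_ku; rewrite -size_c -sum_c.
by elim: c c_gt0 {size_c sum_c} => //= x c IHc /andP[x_gt0 /IHc]; lia.
Qed.

Lemma num_compositionsn0 (k : nat) : num_compositions k 0 = (k == 0).
Proof. by case: k => // k; rewrite num_compositions_small. Qed.

Lemma num_compositionsSS (k u : nat) : num_compositions k.+1 u.+1 = 'C(u, k).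
Proof.
have [le_ku|lt_uk] := leqP k u; last first.
  by rewrite num_compositions_small // bin_small.
rewrite /num_compositions -{1}(subnKC le_ku) -addSn -size_filter.
rewrite (perm_size (perm_positive_weak_compositions _ _)) size_map.
by rewrite size_weak_compositions subnKC.
Qed.

Definition entry_profile (k m : nat) (c : seq nat) : bool :=
  (count (leq 1) c == k) && (count (leq 2) c == m).

Lemma entry_profile_rot (k m i : nat) (c : seq nat) :
  entry_profile k m (rot i c) = entry_profile k m c.
Proof. by rewrite /entry_profile !(permP (permEl (perm_rot i c))). Qed.

Lemma count_entry_profile (L k m v : nat) :
  count (entry_profile k m) (weak_compositions L (k + v)) =
  'C(L, k) * ('C(k, m) * num_compositions m v).
Proof.
transitivity (count (fun c => let d := filter (leq 1) c in
    (size d == k) && (count (leq 2) d == m)) (weak_compositions L (k + v))).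
  apply: eq_count => c /=; rewrite size_filter count_filter.
  by congr (_ && (_ == _)); apply: eq_count => -[|[]].
rewrite (count_nonzero_entries (fun d => count (leq 2) d == m)); congr (_ * _).
under eq_count do rewrite andbC; rewrite -count_filter.
rewrite (permP (perm_positive_weak_compositions k v)) count_map.
have := count_nonzero_entries predT k m v.
under [in RHS]eq_count do rewrite andbT; move <-; apply: eq_count => c /=.
by rewrite count_map andbT size_filter; congr (_ == _); apply: eq_count.
Qed.

(** * Dyck paths as Łukasiewicz sequences *)

Definition ups_down (j : nat) : seq bool := rcons (nseq j stepU) stepD.

Definition word_of_runs (c : seq nat) : seq bool :=
  flatten [seq ups_down x | x <- c].

(* Meaningful for words that end with a down step. *)
Fixpoint runs_of_word (s : seq bool) : seq nat :=
  if s is b :: s' then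
    let c := runs_of_word s' in
    if b then (head 0 c).+1 :: behead c else 0 :: c
  else [::].

Lemma word_of_runs_cons (x : nat) (c : seq nat) :
  word_of_runs (x :: c) = nseq x stepU ++ stepD :: word_of_runs c.
Proof. by rewrite /word_of_runs /= cat_rcons. Qed.

Lemma word_of_runs_rcons (c : seq nat) (x : nat) :
  word_of_runs (rcons c x) = rcons (word_of_runs c ++ nseq x stepU) stepD.
Proof. by rewrite /word_of_runs map_rcons flatten_rcons rcons_cat. Qed.

Lemma word_of_runsK : cancel word_of_runs runs_of_word.
Proof.
elim=> // x c IHc; rewrite word_of_runs_cons.
by elim: x => /= [|x ->]; rewrite ?IHc.
Qed.

Lemma runs_of_wordK (p : seq bool) :
  word_of_runs (runs_of_word (rcons p stepD)) = rcons p stepD.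
Proof.
elim: p => //= -[] p; last by rewrite word_of_runs_cons => ->.
case: (runs_of_word _) => [|x c]; first by case: p.
by rewrite !word_of_runs_cons /= => <-.
Qed.

Lemma size_word_of_runs (c : seq nat) :
  size (word_of_runs c) = size c + sumn c.
Proof.
elim: c => // x c IHc.
by rewrite word_of_runs_cons size_cat size_nseq /= IHc; lia.
Qed.

Lemma occ_cons (u : seq bool) (b : bool) (s : seq bool) :
  occ u (b :: s) = prefix u (b :: s) + occ u s.
Proof.
rewrite /occ /=; congr (_ + _).
by rewrite -[1]addn0 iotaDl count_map.
Qed.

Lemma occ_ups_down (j : nat) (c : seq nat) :
  occ (ups_down j) (word_of_runs c) = count (leq j) c.
Proof.
have prefix_ups_down x s :
    prefix (ups_down j) (nseq x stepU ++ stepD :: s) = (j == x).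
  by elim: j x => [|i IHi] [|x] //=; rewrite prefix0s.
elim: c => // x c IHc; rewrite word_of_runs_cons [RHS]/= -IHc {IHc}.
elim: x => [|x IHx]; first by rewrite occ_cons (prefix_ups_down 0) leqn0.
by rewrite occ_cons (prefix_ups_down x.+1) IHx; lia.
Qed.

Local Open Scope ring_scope.

Definition step_height (b : bool) : int := if b then 1 else -1.

Definition entries_pred (c : seq nat) : seq int := [seq x%:Z - 1 | x <- c].

(* The total [sumn c - size c = -1] is not part of the definition. *)
Definition lukasiewicz (c : seq nat) : bool :=
  nonneg_partial_sums 0 (entries_pred c).

Lemma sum_entries_pred (c : seq nat) :
  \sum_(x <- entries_pred c) x = (sumn c)%:Z - (size c)%:Z.
Proof.
elim: c => [|x c IHc]; first by rewrite big_nil.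
by rewrite /= big_cons IHc; lia.
Qed.

Lemma height_cat (s t : seq bool) : height (s ++ t) = height s + height t.
Proof. by rewrite /height big_cat. Qed.

Lemma height_rcons (s : seq bool) (b : bool) :
  height (rcons s b) = height s + step_height b.
Proof. by rewrite -cats1 height_cat /height big_seq1. Qed.

Lemma height_word_of_runs (c : seq nat) :
  height (word_of_runs c) = (sumn c)%:Z - (size c)%:Z.
Proof.
elim: c => [|x c IHc]; first by rewrite /height big_nil.
rewrite word_of_runs_cons -cat_rcons height_cat height_rcons IHc.
by rewrite /height big_nseq iter_addr addr0 natz /step_height /=; lia.
Qed.

(* Along a run the height is least at both ends. *)
Lemma nonneg_partial_sums_word_of_runs (h : int) (c : seq nat) :
  nonneg_partial_sums h (map step_height (word_of_runs c)) =
  nonneg_partial_sums h (entries_pred c).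
Proof.
elim: c h => // x c IHc h.
rewrite word_of_runs_cons map_cat /= !nonneg_partial_sums_cons -IHc.
elim: x h => [|x IHx] h /=; rewrite nonneg_partial_sums_cons ?sub0r //.
rewrite IHx andbA.
have -> : h + step_height stepU + (x%:Z - 1) = h + (x.+1%:Z - 1).
  by rewrite /step_height; lia.
by congr (_ && _); rewrite /step_height; lia.
Qed.

Lemma dyck_rcons (p : seq bool) :
  dyck p =
  (height p == 0) && nonneg_partial_sums 0 (map step_height (rcons p stepD)).
Proof.
rewrite /dyck /nonneg_partial_sums size_map size_rcons; congr (_ && _).
apply: eq_in_all => i; rewrite mem_iota ltnS => /= le_ip.
by rewrite -map_take big_map -cats1 takel_cat // add0r.
Qed.

Lemma dyck_lukasiewicz (p : seq bool) (c : seq nat) :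
  word_of_runs c = rcons p stepD ->
  dyck p = (size c == (sumn c).+1) && lukasiewicz c.
Proof.
move=> cE; rewrite dyck_rcons -cE nonneg_partial_sums_word_of_runs.
congr (_ && _); have := height_word_of_runs c.
by rewrite cE height_rcons /step_height; lia.
Qed.

Lemma dyck_word_of_runs (p : seq bool) : dyck p -> exists c, p = word_of_runs c.
Proof.
case/lastP: p => [|p b]; first by exists [::].
case: b => [/andP[/eqP + /allP/(_ (size p))]|].
  rewrite height_rcons mem_iota size_rcons -cats1 take_size_cat // /step_height.
  lia.
by exists (runs_of_word (rcons p stepD)); rewrite runs_of_wordK.
Qed.

Local Close Scope ring_scope.

Lemma occ_dyck (j : nat) (p : seq bool) :
  dyck p ->
  occ (ups_down j.+1) p = count (leq j.+1) (runs_of_word (rcons p stepD)).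
Proof.
case/dyck_word_of_runs => c ->; rewrite occ_ups_down.
have := word_of_runs_rcons c 0; rewrite cats0 => <-.
by rewrite word_of_runsK -cats1 count_cat addn0.
Qed.

Lemma mem_runs_of_dyck (n k m : nat) (p : seq bool) :
  size p = n.*2 ->
  (runs_of_word (rcons p stepD) \in
     filter (predI lukasiewicz (entry_profile k m))
       (weak_compositions n.+1 n)) =
  [&& dyck p, occ [:: stepU; stepD] p == k
    & occ [:: stepU; stepU; stepD] p == m].
Proof.
move=> size_p; rewrite mem_filter mem_weak_compositions.
have dyckE := dyck_lukasiewicz (runs_of_wordK p).
have := congr1 size (runs_of_wordK p).
rewrite size_word_of_runs size_rcons size_p.
have [dyck_p|/negPf not_dyck_p] /= := boolP (dyck p).
  have /andP[/eqP size_c ->] := etrans (esym dyckE) dyck_p.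
  rewrite size_c (@occ_dyck 0) // (@occ_dyck 1) // => sum_c.
  have -> : sumn (runs_of_word (rcons p stepD)) = n by lia.
  by rewrite !eqxx !andbT.
by move: dyckE; rewrite not_dyck_p => /esym/negbT; lia.
Qed.

Lemma w_lukasiewicz (n k m : nat) :
  w n k m =
  count (predI lukasiewicz (entry_profile k m)) (weak_compositions n.+1 n).
Proof.
pose runs (p : (n.*2).-tuple bool) := runs_of_word (rcons p stepD).
have runs_inj : injective runs.
  move=> p q /(congr1 word_of_runs); rewrite !runs_of_wordK.
  by case/rcons_inj => /val_inj.
rewrite /w cardE -(size_map runs) -size_filter; apply/perm_size/uniq_perm.
- by rewrite map_inj_uniq ?enum_uniq.
- exact/filter_uniq/weak_compositions_uniq.
move=> c; apply/mapP/idP => [[p + ->]|c_luk].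
  by rewrite mem_enum inE -(mem_runs_of_dyck _ _ (size_tuple p)).
have [/eqP size_c /eqP sum_c] : size c == n.+1 /\ sumn c == n.
  by move: c_luk; rewrite mem_filter mem_weak_compositions => /and3P[].
have [p pE] : exists p, word_of_runs c = rcons p stepD.
  case/lastP: c size_c {c_luk sum_c} => // c x _.
  by exists (word_of_runs c ++ nseq x stepU); apply: word_of_runs_rcons.
have size_p : size p == n.*2.
  have := congr1 size pE.
  by rewrite size_rcons size_word_of_runs size_c sum_c; lia.
have runs_p : runs (Tuple size_p) = c by rewrite /runs /= -pE word_of_runsK.
exists (Tuple size_p) => //; rewrite mem_enum inE.
by rewrite -(mem_runs_of_dyck _ _ (eqP size_p)) -pE word_of_runsK.
Qed.

Lemma perm_map_rot_weak_compositions (L u i : nat) :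
  perm_eq (weak_compositions L u) (map (rot i) (weak_compositions L u)).
Proof.
have rot_i_inj := @rot_inj i nat.
apply: uniq_perm => [||c]; rewrite ?(map_inj_uniq rot_i_inj).
- exact: weak_compositions_uniq.
- exact: weak_compositions_uniq.
rewrite -{2}[c](rotrK i) (mem_map rot_i_inj) !mem_weak_compositions size_rotr.
by rewrite (perm_sumn (permEl (perm_rotr i c))).
Qed.

Lemma exchange_count (S T : Type) (P : S -> T -> bool) (s : seq S) (t : seq T) :
  \sum_(x <- s) count (P x) t = \sum_(y <- t) count (P^~ y) s.
Proof.
under eq_bigr do rewrite -sum1_count big_mkcond.
rewrite exchange_big; apply: eq_bigr => y _.
by rewrite -sum1_count [RHS]big_mkcond.
Qed.

Lemma count_rot_lukasiewicz (c : seq nat) :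
  size c = (sumn c).+1 ->
  count (fun i => lukasiewicz (rot i c)) (iota 0 (size c)) = 1.
Proof.
move=> size_c; rewrite -(@cycle_lemma (entries_pred c)).
  by rewrite size_map; apply: eq_count => i; rewrite /lukasiewicz -map_rot.
by rewrite sum_entries_pred size_c; lia.
Qed.

Lemma mul_count_lukasiewicz (P : pred (seq nat)) (n : nat) :
  (forall i c, P (rot i c) = P c) ->
  n.+1 * count (predI lukasiewicz P) (weak_compositions n.+1 n) =
  count P (weak_compositions n.+1 n).
Proof.
move=> P_rot; set E := weak_compositions n.+1 n.
transitivity
  (\sum_(i <- iota 0 n.+1) count (fun c => lukasiewicz (rot i c) && P c) E).
  rewrite -[n.+1 in LHS](size_iota 0) -sum1_size big_distrl.
  apply: eq_bigr => i _; rewrite /= mul1n.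
  rewrite (permP (perm_map_rot_weak_compositions _ _ i)) count_map.
  by apply: eq_count => c /=; rewrite P_rot.
rewrite exchange_count -sum1_count [RHS]big_mkcond; apply: eq_big_seq => c.
rewrite mem_weak_compositions => /andP[/eqP size_c /eqP sum_c].
case: (P c); under eq_count do rewrite ?andbT ?andbF.
  by rewrite -size_c count_rot_lukasiewicz // sum_c.
by rewrite count_pred0.
Qed.

Lemma w_closed_form (n k m : nat) :
  k <= n ->
  n.+1 * w n k m = 'C(n.+1, k) * ('C(k, m) * num_compositions m (n - k)).
Proof.
move=> le_kn; rewrite w_lukasiewicz mul_count_lukasiewicz.
  by rewrite -{2}(subnKC le_kn) count_entry_profile.
exact: entry_profile_rot.
Qed.

Local Open Scope ring_scope.

(** * Interlacing and sign changes *)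

Lemma path_gt_all (d : Order.disp_t) (T : porderType d) (x : T) (s : seq T) :
  path >%O x s -> {in s, forall y, (y < x)%O}.
Proof. by move/(order_path_min (rev_trans lt_trans))/allP. Qed.

Section StrictInterlacing.

Variable R : numDomainType.
Implicit Types (p q : {poly R}) (c s t : seq R).

(* [t`_0 > s`_0 > t`_1 > s`_1 > ...], with [t] as long as [s] or one longer. *)
Definition strictly_interlaced s t : Prop :=
  [/\ (size s <= size t <= (size s).+1)%N,
      forall i, (i < size s)%N -> s`_i < t`_i &
      forall i, (i.+1 < size t)%N -> t`_i.+1 < s`_i].

Lemma strictly_interlaced_sorted_l s t :
  strictly_interlaced s t -> sorted >%R s.
Proof.
case=> /andP[le_st _] lt_st lt_ts; apply/(sortedP 0) => i lt_is.
by apply: lt_trans (lt_st _ lt_is) (lt_ts _ _); apply: leq_trans le_st.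
Qed.

Lemma strictly_interlaced_sorted_r s t :
  strictly_interlaced s t -> sorted >%R t.
Proof.
case=> /andP[_ le_ts] lt_st lt_ts; apply/(sortedP 0) => i lt_it.
by apply: lt_trans (lt_ts _ lt_it) (lt_st _ _); rewrite -ltnS (leq_trans lt_it).
Qed.

Lemma strictly_interlaced_cons s y t :
  strictly_interlaced s (y :: t) <->
  ((0 < size s)%N -> s`_0 < y) /\ strictly_interlaced t s.
Proof.
split=> [[/= size_s lt_st lt_ts]|[lt_sy [size_t lt_ts lt_st]]].
  split=> [|]; first exact: lt_st.
  by split=> [|i|i]; [lia | apply: lt_ts | apply: lt_st].
split=> [|[|i]|]; [by move=> /=; lia | exact: lt_sy | exact: lt_st |].
exact: lt_ts.
Qed.

Lemma strictly_interlaced_path s y t :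
  strictly_interlaced s (y :: t) -> path >%R y s.
Proof.
move=> st; have := strictly_interlaced_sorted_l st.
case/strictly_interlaced_cons: st => lt_sy _.
by case: s lt_sy => //= x s ->.
Qed.

Definition alternates p c : Prop :=
  forall i, (i < size c)%N -> 0 < (-1) ^+ i * p.[c`_i].

Lemma alternates_cons p x c :
  alternates p (x :: c) <-> 0 < p.[x] /\ alternates (- p) c.
Proof.
split=> [alt_p|[px_gt0 alt_p] [|i] lt_ic].
- split=> [|i lt_ic]; first by have := alt_p 0%N isT; rewrite mul1r.
  by rewrite hornerN mulrN -mulNr -mulN1r -exprS (alt_p i.+1).
- by rewrite mul1r.
by rewrite exprS mulN1r mulNr -mulrN -hornerN alt_p.
Qed.

Lemma alternates_rcons p c x :
  alternates p c -> 0 < (-1) ^+ size c * p.[x] -> alternates p (rcons c x).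
Proof.
move=> alt_p px_sign i; rewrite size_rcons ltnS leq_eqVlt nth_rcons.
by case/predU1P=> [->|lt_ic]; rewrite ?ltnn ?eqxx // lt_ic alt_p.
Qed.

Lemma alternatesM p q c :
  {in c, forall x, 0 < q.[x]} -> alternates p c -> alternates (q * p) c.
Proof.
move=> q_gt0 alt_p i lt_ic.
by rewrite hornerM mulrCA mulr_gt0 ?alt_p ?q_gt0 ?mem_nth.
Qed.

Lemma alternatesZ (a : R) p c :
  0 < a -> alternates p c -> alternates (a *: p) c.
Proof.
by move=> a_gt0; rewrite -mul_polyC; apply: alternatesM => x _; rewrite hornerC.
Qed.

Lemma alternates_prod_XsubC s t :
  strictly_interlaced s t -> alternates (\prod_(a <- s) ('X - a%:P)) t.
Proof.
elim: s t => [|x s IHs] [|y t] // st.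
  by case: t st => [_|a t [] //] [|//] _; rewrite big_nil hornerC mul1r.
have [/(_ isT) lt_xy ts] := (strictly_interlaced_cons _ _ _).1 st.
have [_ {}/IHs alt_t] := (strictly_interlaced_cons _ _ _).1 ts.
have lt_sx := path_gt_all (strictly_interlaced_sorted_l st).
have lt_tx := path_gt_all (strictly_interlaced_path ts).
apply/alternates_cons; split.
  rewrite horner_prod big_seq prodr_gt0 // => a.
  rewrite inE hornerXsubC subr_gt0 => /predU1P[->//|/lt_sx lt_ax].
  exact: lt_trans lt_ax lt_xy.
rewrite big_cons -mulNr; apply: alternatesM alt_t => a /lt_tx.
by rewrite hornerN hornerXsubC oppr_gt0 subr_lt0.
Qed.

End StrictInterlacing.

Section ZerosFromSigns.

Variable R : rcfType.
Implicit Types (p : {poly R}) (c s t : seq R).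

Lemma size_zeros_of p s : p != 0 -> zeros_of p s -> size p = (size s).+1.
Proof.
move=> p_neq0 [_ pE]; rewrite {1}pE size_scale ?lead_coef_eq0 //.
exact: size_prod_XsubC.
Qed.

Lemma alternating_roots p c :
  sorted >%R c -> alternates p c ->
  exists s, [/\ all (root p) s, size s = (size c).-1 & strictly_interlaced s c].
Proof.
elim: c p => [|a [|b c] IHc] p; try by exists [::].
move=> /= /andP[lt_ba lt_c] /alternates_cons[pa_gt0 alt_p].
have [s [roots_s size_s [_ lt_sc lt_cs]]] := IHc (- p) lt_c alt_p.
have /(poly_ivtoo (ltW lt_ba))[x] : p.[b] * p.[a] < 0.
  by have [/[!hornerN] ? _] := (alternates_cons _ _ _).1 alt_p; nra.
rewrite in_itv => /andP[lt_bx lt_xa] px0; exists (x :: s); split=> /=.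
- by rewrite px0; apply: sub_all roots_s => y; rewrite rootN.
- by rewrite size_s.
split; [by rewrite /= size_s /=; lia | by case |].
by case=> // i; apply: lt_cs.
Qed.

Lemma alternating_zeros p c :
  size c = size p -> sorted >%R c -> alternates p c ->
  exists s, [/\ zeros_of p s, size s = (size c).-1 & strictly_interlaced s c].
Proof.
move=> size_c lt_c alt_p.
have [s [roots_s size_s sc]] := alternating_roots lt_c alt_p.
have gt_s := strictly_interlaced_sorted_l sc.
exists s; split=> //; split; first by apply: sub_sorted gt_s => x y /ltW.
have [->|p_neq0] := eqVneq p 0; first by rewrite lead_coef0 scale0r.
apply: all_roots_prod_XsubC => //; first by rewrite size_s size_c polySpred.
rewrite uniq_rootsE; apply: sorted_uniq gt_s; last exact: ltxx.
exact: rev_trans lt_trans.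
Qed.

Lemma sign_near_minfty p x :
  0 < lead_coef p -> exists2 y, y < x & 0 < (-1) ^+ (size p).-1 * p.[y].
Proof.
move=> lead_gt0; have p_neq0 : p != 0 by rewrite -lead_coef_eq0 gt_eqF.
exists (Num.min (- cauchy_bound p) (x - 1)).
  by rewrite gt_min ltrBlDr ltrDl ltr01 orbT.
rewrite -sgr_cp0 sgrM (sgp_minftyP (le_cauchy_bound p_neq0)).
  by rewrite -sgrM mulrA -expr2 sqrr_sign mul1r gtr0_sg.
by rewrite in_itv /= ge_min lexx.
Qed.

(* When [c] is one point short, the last sign change is found near -oo. *)
Lemma alternating_zeros_leq p c :
  0 < lead_coef p -> (size c <= size p <= (size c).+1)%N ->
  sorted >%R c -> alternates p c ->
  exists2 s, zeros_of p s & strictly_interlaced s c.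
Proof.
move=> lead_gt0 size_p lt_c alt_p.
have [size_c|ltn_cp] := eqVneq (size c) (size p).
  by have [s [zeros_s _ sc]] := alternating_zeros size_c lt_c alt_p; exists s.
have {}size_p : size p = (size c).+1 by lia.
have [y lt_yc sign_y] := sign_near_minfty (last 0 c) lead_gt0.
have [|||s [zeros_s size_s [_ lt_sc lt_cs]]] :=
  @alternating_zeros p (rcons c y).
- by rewrite size_rcons.
- by case: (c) lt_c lt_yc => //= a d lt_d lt_yd; rewrite rcons_path lt_d.
- by apply: alternates_rcons; rewrite // size_p in sign_y.
rewrite size_rcons /= in size_s lt_cs; exists s => //.
have nth_c i : (i < size c)%N -> (rcons c y)`_i = c`_i.
  by move=> lt_ic; rewrite nth_rcons lt_ic.
split=> [|i lt_is|i lt_ic].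
- by rewrite size_s leqnn leqnSn.
- by rewrite -nth_c -?size_s ?lt_sc.
- by rewrite -nth_c ?lt_cs // ltnW.
Qed.

End ZerosFromSigns.

Section SturmChain.

Variables (R : rcfType) (P : nat -> {poly R}).
Hypotheses (size_P0 : size (P 0) = 1%N)
  (size_PS : forall r, (size (P r) <= size (P r.+1) <= (size (P r)).+1)%N)
  (lead_P_gt0 : forall r, 0 < lead_coef (P r))
  (P_at0_gt0 : forall r, 0 < (P r).[0])
  (P_sign_change : forall r x, x < 0 -> root (P r.+1) x ->
     exists2 a, 0 < a & (P r.+2).[x] = - a * (P r).[x]).

Lemma Sturm_chain (r : nat) :
  exists s t, [/\ zeros_of (P r) s, zeros_of (P r.+1) t &
    strictly_interlaced t (0 :: s)].
Proof.
elim: r => [|r [s [t [zeros_s zeros_t ts]]]].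
  exists [::].
  have [||||t zeros_t t0] := @alternating_zeros_leq _ (P 1) [:: 0] => //.
  - by have := size_PS 0; rewrite size_P0.
  - by case=> // _; rewrite mul1r.
  exists t; split=> //; split=> //.
  by apply: all_roots_prod_XsubC; rewrite ?size_P0.
have [_ st] := (strictly_interlaced_cons _ _ _).1 ts.
have t_path := strictly_interlaced_path ts.
have alt_Pr : alternates (P r) t.
  by case: zeros_s => _ ->; apply/alternatesZ/alternates_prod_XsubC.
have alt_PrSS : alternates (P r.+2) (0 :: t).
  apply/alternates_cons; split=> // i lt_it.
  have ti_lt0 : t`_i < 0 by exact: path_gt_all t_path _ (mem_nth _ lt_it).
  have [|a a_gt0 signP] := @P_sign_change r t`_i ti_lt0.
    by rewrite zeros_t.2 rootZ ?gt_eqF // root_prod_XsubC mem_nth.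
  by rewrite hornerN signP mulNr opprK mulrCA mulr_gt0 ?alt_Pr.
have size_P1 : size (P r.+1) = (size t).+1.
  by apply: size_zeros_of zeros_t; rewrite -lead_coef_eq0 gt_eqF.
have [||||u zeros_u ut] := @alternating_zeros_leq _ (P r.+2) (0 :: t) => //.
  by rewrite /= -size_P1.
by exists t, u.
Qed.

End SturmChain.

(** * Contiguous hypergeometric polynomials *)

(* [k.+1] times the hypergeometric polynomial 2F1(-k, -r; 2; x). *)
Definition hypergeom (R : nzRingType) (k r : nat) : {poly R} :=
  \poly_(j < (minn r k).+1) ('C(k.+1, j.+1) * 'C(r, j))%:R.

Lemma coef_hypergeom (R : nzRingType) (k r j : nat) :
  (hypergeom R k r)`_j = ('C(k.+1, j.+1) * 'C(r, j))%:R.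
Proof.
rewrite coef_poly ltnS leq_min; have [le_jr|lt_rj] /= := leqP j r.
  by case: leqP => // lt_kj; rewrite bin_small.
by rewrite (bin_small lt_rj) muln0.
Qed.

Lemma horner0_hypergeom (R : nzRingType) (k r : nat) :
  (hypergeom R k r).[0] = k.+1%:R.
Proof. by rewrite horner_coef0 coef_hypergeom bin0 bin1 muln1. Qed.

Lemma muln_bin_minn_gt0 (k r : nat) :
  (0 < 'C(k.+1, (minn r k).+1) * 'C(r, minn r k))%N.
Proof. by rewrite muln_gt0 !bin_gt0 ltnS geq_minr geq_minl. Qed.

Lemma size_hypergeom (R : numDomainType) (k r : nat) :
  size (hypergeom R k r) = (minn r k).+1.
Proof. by apply: size_poly_eq; rewrite pnatr_eq0 -lt0n muln_bin_minn_gt0. Qed.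

Lemma lead_coef_hypergeom_gt0 (R : numDomainType) (k r : nat) :
  0 < lead_coef (hypergeom R k r).
Proof.
by rewrite lead_coefE size_hypergeom coef_hypergeom ltr0n muln_bin_minn_gt0.
Qed.

Lemma hypergeom0 (R : numDomainType) (k : nat) : hypergeom R k 0 = k.+1%:R%:P.
Proof.
rewrite -(horner0_hypergeom R k 0) horner_coef0 -size1_polyC //.
by rewrite size_hypergeom min0n.
Qed.

Lemma natrB_mul_bin (R : nzRingType) (n m : nat) :
  (n - m)%:R * 'C(n, m)%:R = (n%:R - m%:R) * 'C(n, m)%:R :> R.
Proof.
have [le_mn|lt_nm] := leqP m n; first by rewrite natrB.
by rewrite bin_small ?mulr0.
Qed.

(* Gauss' contiguous relation in the second parameter. *)
Lemma hypergeom_contiguous (R : comNzRingType) (k r : nat) :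
  r.+3%:R *: hypergeom R k r.+2 =
  (2 * r.+2%:R) *: hypergeom R k r.+1 +
  (k%:R - r.+1%:R) *: ('X * hypergeom R k r.+1) +
  r.+1%:R *: ('X * hypergeom R k r - hypergeom R k r).
Proof.
apply/polyP => -[|j]; rewrite !(coefZ, coefD, coefN, coefXM, coef_hypergeom).
  by rewrite /= !bin0 bin1 !muln1; ring.
have lower_k : j.+2%:R * 'C(k.+1, j.+2)%:R =
    (k.+1%:R - j.+1%:R) * 'C(k.+1, j.+1)%:R :> R.
  by rewrite -natrM mul_bin_left natrM natrB_mul_bin.
have lower_r : r.+1%:R * 'C(r, j)%:R = (r.+1%:R - j%:R) * 'C(r.+1, j)%:R :> R.
  by rewrite -natrM (mul_bin_down r.+1) natrM natrB_mul_bin.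
rewrite [j.+1.-1]/= !natrM; move: lower_k lower_r.
set a := 'C(k.+1, j.+2)%:R; set b := 'C(k.+1, j.+1)%:R.
rewrite (binS r.+1 j) (binS r j) !natrD.
set c := 'C(r, j.+1)%:R; set d := 'C(r.+1, j)%:R; set e := 'C(r, j)%:R.
move=> /= lower_k lower_r; apply/subr0_eq.
transitivity (d * (j.+2%:R * a - (k.+1%:R - j.+1%:R) * b)
  - (a + b) * (r.+1%:R * e - (r.+1%:R - j%:R) * d)); first by ring.
by rewrite lower_k lower_r !subrr !mulr0 subrr.
Qed.

Lemma hypergeom_zeros (R : rcfType) (k r : nat) :
  exists s t, [/\ zeros_of (hypergeom R k r) s,
    zeros_of (hypergeom R k r.+1) t & strictly_interlaced t (0 :: s)].
Proof.
apply: Sturm_chain => [|q|q|q|q x x_lt0 /eqP root_x].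
- by rewrite size_hypergeom min0n.
- by rewrite !size_hypergeom; lia.
- exact: lead_coef_hypergeom_gt0.
- by rewrite horner0_hypergeom ltr0n.
have := congr1 (horner^~ x) (hypergeom_contiguous R k q).
rewrite !(hornerZ, hornerD, hornerN, hornerM, hornerX) root_x !mulr0 !add0r.
move=> contiguous_x; exists (q.+1%:R * (1 - x) / q.+3%:R).
  by rewrite divr_gt0 ?mulr_gt0 ?ltr0n //; lra.
have q3_neq0 : q.+3%:R != 0 :> R by rewrite pnatr_eq0.
apply: (mulfI q3_neq0); rewrite contiguous_x; field.
by rewrite -natrD pnatr_eq0.
Qed.

(** * The polynomials W *)

Lemma coef_W (R : rcfType) (n k m : nat) :
  (W R n k)`_m = if (m <= k)%N then (w n k m)%:R else 0.
Proof.
by rewrite /W big_mkord -(poly_def _ (fun m => (w n k m)%:R)) coef_poly ltnS.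
Qed.

Lemma nonneg_coefs_W (R : rcfType) (n k : nat) : nonneg_coefs (W R n k).
Proof. by move=> m; rewrite coef_W; case: leqP. Qed.

Lemma W_diag (R : rcfType) (k : nat) : W R k k = 1.
Proof.
apply/polyP => m; rewrite coef_W coef1.
have := w_closed_form m (leqnn k); rewrite subnn num_compositionsn0 binSn.
move/eqP; rewrite eqn_pmul2l // => /eqP->.
by case: m => [|m]; rewrite ?bin0 // muln0 if_same.
Qed.

Lemma W_hypergeom (R : rcfType) (k r : nat) (n := (k.+1 + r.+1)%N) :
  W R n k.+1 = ('C(n.+1, k.+1)%:R / n.+1%:R) *: ('X * hypergeom R k r).
Proof.
have n1_neq0 : n.+1%:R != 0 :> R by rewrite pnatr_eq0.
apply/polyP => m; rewrite coef_W coefZ coefXM; apply: (mulfI n1_neq0).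
rewrite mulrA mulrCA divff // mulr1.
have -> : (if m == 0%N then 0 else (hypergeom R k r)`_m.-1) =
          ('C(k.+1, m) * num_compositions m r.+1)%:R.
  by case: m => [|m]; rewrite /= ?muln0 // coef_hypergeom num_compositionsSS.
have [le_mk|lt_km] := leqP m k.+1; last by rewrite (bin_small lt_km) !mulr0.
by rewrite -!natrM w_closed_form ?leq_addr // addKn.
Qed.

Lemma W_neq0 (R : rcfType) (k r : nat) : W R (k.+1 + r.+1) k.+1 != 0.
Proof.
rewrite W_hypergeom scaler_eq0 negb_or !mulf_neq0 ?polyX_eq0 //.
- by rewrite -lead_coef_eq0 gt_eqF ?lead_coef_hypergeom_gt0.
- by rewrite pnatr_eq0 -lt0n bin_gt0 leqW ?leq_addr.
by rewrite invr_eq0 pnatr_eq0.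
Qed.

Lemma zeros_of_scale_mulX (R : rcfType) (a : R) (p : {poly R}) (s : seq R) :
  path >%R 0 s -> zeros_of p s -> zeros_of (a *: ('X * p)) (0 :: s).
Proof.
move=> s_lt0 [_ pE]; split; first by apply: sub_path s_lt0 => x y /ltW.
rewrite lead_coefZ lead_coefM lead_coefX mul1r big_cons subr0.
by rewrite -[RHS]scalerA (scalerAr (lead_coef _)) -pE.
Qed.

Lemma W_zeros (R : rcfType) (k r : nat) :
  exists s t, [/\ zeros_of (W R (k.+1 + r.+1) k.+1) (0 :: s),
    zeros_of (W R (k.+1 + r.+2) k.+1) (0 :: t) &
    strictly_interlaced t (0 :: s)].
Proof.
have [s [t [zeros_s zeros_t ts]]] := hypergeom_zeros R k r.
exists s, t; rewrite !W_hypergeom; split=> //; apply: zeros_of_scale_mulX => //.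
  exact: strictly_interlaced_sorted_r ts.
exact: strictly_interlaced_path ts.
Qed.

Lemma interlaces_common_max_zero (R : rcfType) (p q : {poly R}) (x : R)
    (s t : seq R) :
  p != 0 -> q != 0 -> nonneg_coefs p -> nonneg_coefs q ->
  zeros_of p (x :: s) -> zeros_of q (x :: t) ->
  strictly_interlaced t (x :: s) -> interlaces p q.
Proof.
move=> p_neq0 q_neq0 p_ge0 q_ge0 zeros_p zeros_q [/= size_t lt_ts lt_st].
apply: Or41; split=> //; split.
  rewrite (size_zeros_of p_neq0 zeros_p) (size_zeros_of q_neq0 zeros_q) /=; lia.
exists (x :: t), (x :: s); split=> // [[|i] // lt_is|i lt_it]; apply/ltW.
  exact: lt_st.
exact: lt_ts.
Qed.

Lemma W_diag_interlaces (R : rcfType) (k : nat) :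
  interlaces (W R k.+1 k.+1) (W R k.+2 k.+1).
Proof.
rewrite W_diag -[k.+2]addn1 W_hypergeom hypergeom0; set a := _ / _.
apply: Or42; exists 1, (a * k.+1%:R), 0.
by rewrite addr0 mulrC mul_polyC scalerA.
Qed.

Theorem theorem2p4 (R : rcfType) (k : nat) (hk : (1 <= k)%N) :
  generalized_Sturm k (fun n => W R n k).
Proof.
case: k hk => // k _; split=> n; rewrite leq_eqVlt => /predU1P[<-|lt_kn].
- rewrite W_diag; exists [::]; split=> //.
  by rewrite big_nil lead_coef1 scale1r.
- have -> : n = (k.+1 + (n - k.+2).+1)%N by lia.
  by have [s [t [zeros_s _ _]]] := W_zeros R k (n - k.+2); exists (0 :: s).
- exact: W_diag_interlaces.
have -> : n = (k.+1 + (n - k.+2).+1)%N by lia.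
have [s [t [zeros_s zeros_t ts]]] := W_zeros R k (n - k.+2).
rewrite -addnS; apply: interlaces_common_max_zero zeros_s zeros_t ts;
  by [apply: W_neq0 | apply: nonneg_coefs_W].
Qed.
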